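(* Let $S$ be a finite set of primes with $2,3\in S$, and let $\mathbb Z_S$ be the ring of $S$-integers. Let $\mathcal Y(\mathbb Z_S)$ be the set of (isomorphism classes of) pairs $(E,P)$ where $E$ is an elliptic curve over $\mathbb Q$ with good reduction outside $S$ and $P$ is a $\mathbb Z_S$-point of the smooth model of $E$ over $\mathbb Z_S$ punctured at the origin; $\{\pm1\}$ acts by $(E,P)\mapsto(E,\pm P)$ (negation in the group law). Define $\kappa$ as follows: write $E$ as $y^2=x^3+a_4x+a_6$ with $a_4,a_6\in\mathbb Z_S$ and discriminant an $S$-unit, so that $P=(x_t,y_t)$ with $x_t,y_t\in\mathbb Z_S$, and set $\kappa(E,P)$ to be the class of the pair $\big(v,\ u^4-6x_tu^2v^2-8y_tuv^3-(3x_t^2+4a_4)v^4\big)$. Then $\kappa$ induces a (well-defined) bijection $$\kappa:\ \mathcal Y(\mathbb Z_S)/\{\pm1\}\longrightarrow\{S\text{-admissible pairs}\}/\sim,$$ where $\sim$ is $\mathrm{GL}_2$-equivalence.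
   Context: An $S$-admissible pair is a pair $(L,Q)$ of binary forms $L=b_0u+b_1v$, $Q=c_0u^4+c_1u^3v+c_2u^2v^2+c_3uv^3+c_4v^4$ with coefficients in $\mathbb Z_S$ such that $b_0,b_1$ generate the unit ideal of $\mathbb Z_S$, $c_0,\dots,c_4$ generate the unit ideal of $\mathbb Z_S$, and the discriminant $\Delta_Q\cdot Q(-b_1,b_0)^2$ of $L\cdot Q$ is an $S$-unit ($\Delta_Q$ the discriminant of the quartic $Q$). Two $S$-admissible pairs $(L,Q),(L',Q')$ are $\mathrm{GL}_2$-equivalent if there exist $g\in\mathrm{GL}_2(\mathbb Z_S)$ and $\lambda_1,\lambda_2\in\mathbb Z_S^\times$ with $(L^g,Q^g)=(\lambda_1L',\lambda_2Q')$, where $g$ acts by linear change of the variables $u,v$. *)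

(* Defs.v *)
From HB Require Import structures.
From mathcomp Require Import all_boot all_order all_algebra.
From mathcomp Require Import finmap mpoly classical_sets functions ring.
Set Implicit Arguments.
Unset Strict Implicit.
Unset Printing Implicit Defensive.
Import GRing.Theory.
Local Open Scope ring_scope.

(* The subring Z[1/p : p in pi] of rat.  For a set S of primes,
   [integers S] is Z_S; for a prime p, [integers p^'] is the local ring
   Z_(p). *)
Definition integers (pi : nat_pred) : {pred rat} :=
  [pred x : rat | pi.-nat `|denq x|%N].

Definition int_units (pi : nat_pred) : {pred rat} :=
  [pred x : rat | [&& x != 0, x \in integers pi & x^-1 \in integers pi]].

Definition fset_pred (S : {fset nat}) : nat_pred := [pred p in S].
Coercion fset_pred : finset_of >-> nat_pred.

(* y^2 + a1 x y + a3 y = x^3 + a2 x^2 + a4 x + a6 *)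
Record weierstrass := Weierstrass { a1 : rat; a2 : rat; a3 : rat;
                                    a4 : rat; a6 : rat }.

Definition wdisc (W : weierstrass) : rat :=
  let b2 := a1 W ^+ 2 + 4 * a2 W in
  let b4 := 2 * a4 W + a1 W * a3 W in
  let b6 := a3 W ^+ 2 + 4 * a6 W in
  let b8 := a1 W ^+ 2 * a6 W + 4 * a2 W * a6 W - a1 W * a3 W * a4 W
            + a2 W * a3 W ^+ 2 - a4 W ^+ 2 in
  - b2 ^+ 2 * b8 - 8 * b4 ^+ 3 - 27 * b6 ^+ 2 + 9 * b2 * b4 * b6.

(* A Weierstrass equation with an affine point: the points of E other than the
   origin are exactly the affine ones. *)
Record marked_curve := Marked { curve : weierstrass; px : rat; py : rat }.

Definition on_curve (m : marked_curve) : Prop :=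
  let W := curve m in let x := px m in let y := py m in
  y ^+ 2 + a1 W * x * y + a3 W * y = x ^+ 3 + a2 W * x ^+ 2 + a4 W * x + a6 W.

(* The change of coordinates x = u^2 x' + r, y = u^3 y' + s u^2 x' + t, with
   u != 0; the isomorphisms of elliptic curves in Weierstrass form are exactly
   these. *)
Record wchange := WChange { cu : rat; cr : rat; cs : rat; ct : rat }.

Definition change_curve (h : wchange) (W : weierstrass) : weierstrass :=
  let: WChange u r s t := h in
  Weierstrass
    ((a1 W + 2 * s) / u)
    ((a2 W - s * a1 W + 3 * r - s ^+ 2) / u ^+ 2)
    ((a3 W + r * a1 W + 2 * t) / u ^+ 3)
    ((a4 W - s * a3 W + 2 * r * a2 W - (t + r * s) * a1 W + 3 * r ^+ 2
      - 2 * s * t) / u ^+ 4)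
    ((a6 W + r * a4 W + r ^+ 2 * a2 W + r ^+ 3 - t * a3 W - t ^+ 2
      - r * t * a1 W) / u ^+ 6).

Definition change (h : wchange) (m : marked_curve) : marked_curve :=
  let: WChange u r s t := h in
  Marked (change_curve h (curve m))
         ((px m - r) / u ^+ 2)
         ((py m - s * (px m - r) - t) / u ^+ 3).

Lemma on_curve_change (h : wchange) (m : marked_curve) :
  cu h != 0 -> on_curve (change h m) <-> on_curve m.
Proof.
case: h m => u r s t [[A1 A2 A3 A4 A6] x y] /= u0; rewrite /on_curve /=.
set lhs := LHS; set rhs := RHS.
have -> : (y ^+ 2 + A1 * x * y + A3 * y
           = x ^+ 3 + A2 * x ^+ 2 + A4 * x + A6) <->
          (y ^+ 2 + A1 * x * y + A3 * y
           - (x ^+ 3 + A2 * x ^+ 2 + A4 * x + A6) = 0).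
  by split=> [->|/eqP]; rewrite ?subrr // subr_eq0 => /eqP.
have -> : y ^+ 2 + A1 * x * y + A3 * y
          - (x ^+ 3 + A2 * x ^+ 2 + A4 * x + A6) = u ^+ 6 * (lhs - rhs).
  by rewrite /lhs /rhs; field.
split=> [->|/eqP]; first by rewrite subrr mulr0.
by rewrite mulf_eq0 expf_eq0 (negPf u0) /= subr_eq0 => /eqP.
Qed.

Lemma wdisc_change (h : wchange) (W : weierstrass) :
  cu h != 0 -> wdisc (change_curve h W) = wdisc W / cu h ^+ 12.
Proof.
by case: h W => u r s t [A1 A2 A3 A4 A6] /= u0; rewrite /wdisc /=; field.
Qed.

Definition isom (m m' : marked_curve) : Prop :=
  exists2 h : wchange, cu h != 0 & change h m = m'.

(* Negation in the group law: -P is the other point of E on the vertical line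
   through P. *)
Definition opp_point (m : marked_curve) : marked_curve :=
  let W := curve m in Marked W (px m) (- py m - a1 W * px m - a3 W).

Definition smooth_at (p : nat) (W : weierstrass) : Prop :=
  [/\ [/\ a1 W \in integers p^', a2 W \in integers p^' &
          a3 W \in integers p^'],
      a4 W \in integers p^', a6 W \in integers p^' &
      wdisc W \in int_units p^'].

Definition good_reduction (p : nat) (W : weierstrass) : Prop :=
  exists2 h : wchange, cu h != 0 & smooth_at p (change_curve h W).

(* A Z_S-point of the smooth model of E minus its zero section is a rational
   point of E whose reduction, for each p outside S, is not the origin; that is,
   whose coordinates in the smooth Weierstrass models at p (unique up to
   isomorphism over Z_(p)) are p-integral. *)
Definition integral_outside (S : {fset nat}) (m : marked_curve) : Prop :=
  forall (p : nat) (h : wchange), prime p -> p \notin S -> cu h != 0 ->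
    smooth_at p (change_curve h (curve m)) ->
    px (change h m) \in integers p^' /\ py (change h m) \in integers p^'.

Definition calY (S : {fset nat}) : set marked_curve :=
  [set m | [/\ wdisc (curve m) != 0, on_curve m,
               forall p, prime p -> p \notin S -> good_reduction p (curve m) &
               integral_outside S m]].

(* (E, P) and (E', P') have the same class in Y(Z_S)/{+-1} *)
Definition isom_pm (m m' : marked_curve) : Prop :=
  isom m m' \/ isom m (opp_point m').

(* Binary forms in u = 'X_0, v = 'X_1 *)
Definition bu : {mpoly rat[2]} := 'X_ord0.
Definition bv : {mpoly rat[2]} := 'X_ord_max.

Definition bform (n : nat) (c : 'rV[rat]_n.+1) : {mpoly rat[2]} :=
  \sum_(i < n.+1) c 0 i *: (bu ^+ (n - i) * bv ^+ i).

Definition point2 (x y : rat) : 'I_2 -> rat := tnth [tuple x; y].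

(* F^g (u, v) = F (g00 u + g01 v, g10 u + g11 v) *)
Definition bact (g : 'M[rat]_2) (F : {mpoly rat[2]}) : {mpoly rat[2]} :=
  F \mPo [tuple g i 0 *: bu + g i 1 *: bv | i < 2].

(* Discriminant of c0 u^4 + c1 u^3 v + c2 u^2 v^2 + c3 u v^3 + c4 v^4, in terms
   of the invariants I and J; it is defined also when c0 = 0. *)
Definition quartic_disc (c0 c1 c2 c3 c4 : rat) : rat :=
  let I := 12 * c0 * c4 - 3 * c1 * c3 + c2 ^+ 2 in
  let J := 72 * c0 * c2 * c4 + 9 * c1 * c2 * c3 - 27 * c0 * c3 ^+ 2
           - 27 * c4 * c1 ^+ 2 - 2 * c2 ^+ 3 in
  (4 * I ^+ 3 - J ^+ 2) / 27.

(* It is the usual discriminant a^6 \prod_(i < j) (r_i - r_j)^2 of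
   a \prod_i (u - r_i v). *)
Lemma quartic_disc_roots (a r1 r2 r3 r4 : rat) :
  quartic_disc a (- a * (r1 + r2 + r3 + r4))
    (a * (r1 * r2 + r1 * r3 + r1 * r4 + r2 * r3 + r2 * r4 + r3 * r4))
    (- a * (r1 * r2 * r3 + r1 * r2 * r4 + r1 * r3 * r4 + r2 * r3 * r4))
    (a * (r1 * r2 * r3 * r4)) =
  a ^+ 6 * ((r1 - r2) * (r1 - r3) * (r1 - r4) * (r2 - r3) * (r2 - r4)
            * (r3 - r4)) ^+ 2.
Proof. by rewrite /quartic_disc; field. Qed.

Definition form_disc (c : 'rV[rat]_5) : rat :=
  quartic_disc (c 0 (inord 0)) (c 0 (inord 1)) (c 0 (inord 2))
               (c 0 (inord 3)) (c 0 (inord 4)).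

Definition unimodular (pi : nat_pred) (n : nat) (c : 'rV[rat]_n) : Prop :=
  exists2 d : 'cV[rat]_n, d \is a mxOver (integers pi) & c *m d = 1%:M.

Definition form_pair : Type := ({mpoly rat[2]} * {mpoly rat[2]})%type.

Definition admissible (S : {fset nat}) : set form_pair :=
  [set F | exists (b : 'rV[rat]_2) (c : 'rV[rat]_5),
    [/\ F = (bform b, bform c),
        b \is a mxOver (integers S) /\ unimodular S b,
        c \is a mxOver (integers S) /\ unimodular S c &
        form_disc c * (bform c).@[point2 (- b 0 1) (b 0 0)] ^+ 2
          \in int_units S]].

Definition GL2_equiv (S : {fset nat}) (F F' : form_pair) : Prop :=
  exists (g : 'M[rat]_2) (l1 l2 : rat),
    [/\ g \is a mxOver (integers S) /\ \det g \in int_units S,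
        l1 \in int_units S, l2 \in int_units S &
        (bact g F.1, bact g F.2) = (l1 *: F'.1, l2 *: F'.2)].

Definition eqclass (T : Type) (D : set T) (r : T -> T -> Prop) (x : T) : set T :=
  [set y | D y /\ r x y].

Definition quotient_set (T : Type) (D : set T) (r : T -> T -> Prop) :
  set (set T) := [set C | exists2 x, D x & C = eqclass D r x].

Definition short (A4 A6 : rat) : weierstrass := Weierstrass 0 0 0 A4 A6.

(* (E, P) written as the point (x, y) of y^2 = x^3 + A4 x + A6 with A4, A6 in
   Z_S and S-unit discriminant *)
Definition short_form (S : {fset nat}) (m : marked_curve) (A4 A6 x y : rat) :
  Prop :=
  [/\ A4 \in integers S, A6 \in integers S, wdisc (short A4 A6) \in int_units S
    & isom m (Marked (short A4 A6) x y)].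

Definition kappa_pair (A4 x y : rat) : form_pair :=
  (bv, bu ^+ 4 - (6 * x) *: (bu ^+ 2 * bv ^+ 2) - (8 * y) *: (bu * bv ^+ 3)
       - (3 * x ^+ 2 + 4 * A4) *: bv ^+ 4).

(* Main.v *)
(* A Weierstrass model can be scaled to a short one over Z_S with S-unit
   discriminant: good reduction outside S says that the discriminant is,
   locally at each prime outside S, a unit times a 12th power, and Z_S is a
   principal ideal domain, so it is an S-unit times a 12th power. Two such
   models of the same marked curve differ by (x, y) -> (x / w^2, y / w^3) with w
   an S-unit, which on the forms is the substitution u -> w u; conversely, a
   substitution relating two pairs (v, Q) with Q monic without u^3 v term must
   be diagonal. The discriminant of the quartic of (E, P) is 2^8 times that of
   E, as its invariants are I = - 48 a4 and J = - 1728 a6. Finally, since the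
   coefficients of L are coprime, L can be moved to v; then the leading
   coefficient Q(- b1, b0) of Q is an S-unit, and Q becomes monic and loses its
   u^3 v term, as 2 and 3 are invertible. *)
Require Import Defs.
From HB Require Import structures.
From mathcomp Require Import all_boot all_order all_algebra.
From mathcomp Require Import finmap mpoly classical_sets functions ring lra.
Set Implicit Arguments.
Unset Strict Implicit.
Unset Printing Implicit Defensive.
Import GRing.Theory Num.Theory.
Local Open Scope ring_scope.

(** * S-integers and S-units *)

(** In lowest terms [x = a / b], the hypothesis reads [a^n d = z b^n], so [b^n] divides [d]. The
    case [n = 1] admits denominators that are not reduced; larger [n] show that [integers pi] is
    closed under roots. *)
Lemma integers_root (pi : nat_pred) (x : rat) (n d : nat) (z : int) :
  (0 < n)%N -> pi.-nat d -> x ^+ n * d%:R = z%:~R -> x \in integers pi.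
Proof.
move=> n_gt0 pi_d; rewrite -{1}[x]divq_num_den expr_div_n inE.
have := coprime_num_den x; have := denq_neq0 x.
move: (numq x) (denq x) => a b b0 co_ab def_z; apply: pnat_dvd pi_d.
have bn0 : b%:~R ^+ n != 0 :> rat by rewrite expf_neq0 // intr_eq0.
have /eqP : a%:~R ^+ n * d%:Z%:~R = z%:~R * b%:~R ^+ n :> rat.
  by rewrite -def_z mulrAC mulfVK.
rewrite -!rmorphXn -!rmorphM eqr_int => /eqP eq_nd.
have : (`|b| ^ n %| `|a| ^ n * d)%N.
  by rewrite -!abszX -[d]/(`|d%:Z|%N) -abszM eq_nd abszM dvdn_mull.
rewrite Gauss_dvdr; last first.
  by rewrite coprimeXl // coprimeXr // coprime_sym.
by apply: dvdn_trans; rewrite dvdn_exp.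
Qed.

Lemma integersP (pi : nat_pred) (x : rat) :
  reflect (exists2 d : nat, pi.-nat d & exists z : int, x * d%:R = z%:~R)
          (x \in integers pi).
Proof.
apply: (iffP idP) => [|[d pi_d [z def_z]]].
  rewrite inE => pi_x; exists `|denq x|%N => //; exists (numq x).
  by rewrite numqE -[(denq x)%:~R]/((denq x)%:~R : rat) -{2}absz_denq.
exact: (@integers_root _ _ 1 _ z _ pi_d).
Qed.

Fact integers_subring (pi : nat_pred) : subring_closed (integers pi).
Proof.
split=> [|x y /integersP[d pi_d [z def_z]] /integersP[e pi_e [w def_w]]|
          x y /integersP[d pi_d [z def_z]] /integersP[e pi_e [w def_w]]].
- by apply/integersP; exists 1%N => //; exists 1; rewrite mulr1.
- apply/integersP; exists (d * e)%N; first by rewrite pnatM pi_d.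
  exists (z * e - w * d).
  by rewrite natrM rmorphB !rmorphM /= -def_z -def_w -!pmulrn; ring.
- apply/integersP; exists (d * e)%N; first by rewrite pnatM pi_d.
  by exists (z * w); rewrite natrM rmorphM /= -def_z -def_w; ring.
Qed.
HB.instance Definition _ (pi : nat_pred) :=
  GRing.isSubringClosed.Build rat (integers pi) (integers_subring pi).

Fact int_units_divr (pi : nat_pred) : divr_closed (int_units pi).
Proof.
split=> [|x y]; first by apply/and3P; rewrite invr1 rpred1 oner_neq0.
move=> /and3P[x0 xS xVS] /and3P[y0 yS yVS].
by apply/and3P; rewrite mulf_neq0 ?invr_eq0 // invf_div !rpredM.
Qed.
HB.instance Definition _ (pi : nat_pred) :=
  GRing.isDivClosed.Build rat (int_units pi) (int_units_divr pi).

Section UnitFacts.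
Variable pi : nat_pred.

Lemma unit_neq0 x : x \in int_units pi -> x != 0.
Proof. by case/and3P. Qed.

Lemma unit_integer x : x \in int_units pi -> x \in integers pi.
Proof. by case/and3P. Qed.

Lemma unit_integerV x : x \in int_units pi -> x^-1 \in integers pi.
Proof. by case/and3P. Qed.

Lemma integer_root n x :
  (0 < n)%N -> x ^+ n \in integers pi -> x \in integers pi.
Proof.
by move=> n_gt0 /integersP[d pi_d [z def_z]]; apply: integers_root pi_d def_z.
Qed.

(** With [n = 12], it turns a unit ratio of discriminants into a unit scaling factor. *)
Lemma unit_root n x :
  (0 < n)%N -> x ^+ n \in int_units pi -> x \in int_units pi.
Proof.
move=> n_gt0 /and3P[xn0 xnS xVnS]; apply/and3P; split.
- by move: xn0; rewrite expf_eq0 n_gt0.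
- exact: integer_root xnS.
- by apply: (@integer_root n) => //; rewrite exprVn.
Qed.

Lemma unit_factor x y :
  x \in integers pi -> y \in integers pi -> x * y \in int_units pi ->
  x \in int_units pi.
Proof.
move=> xS yS /and3P[]; rewrite mulf_eq0 => /norP[x0 y0] _ xyVS.
apply/and3P; split=> //.
suff -> : x^-1 = y * (x * y)^-1 by rewrite rpredM.
by rewrite invfM mulrCA mulfV ?mulr1.
Qed.

(** Splits the admissibility condition: the discriminant of Q and the value Q(-b1, b0) are both
    S-units. *)
Lemma unit_factor_sqr x y :
  x \in integers pi -> y \in integers pi -> x * y ^+ 2 \in int_units pi ->
  x \in int_units pi /\ y \in int_units pi.
Proof.
move=> xS yS xyu; split; first by apply: unit_factor (rpredX 2 yS) xyu.
by apply: unit_factor (rpredM xS yS) _; rewrite // mulrCA -expr2.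
Qed.

Lemma nat_unit n : pi.-nat n -> n%:R \in int_units pi.
Proof.
move=> pi_n.
have n0 : n%:R != 0 :> rat by rewrite pnatr_eq0 -lt0n; case/andP: pi_n.
apply/and3P; split=> //; first exact: rpred_nat.
by apply/integersP; exists n => //; exists 1; rewrite mulVf.
Qed.

End UnitFacts.

(** * From all primes outside S to Z_S *)

Section LocalGlobal.
Variable S : {fset nat}.

Lemma pnat_outside n :
  (0 < n)%N -> (forall p, prime p -> p \notin S -> p^'.-nat n) -> S.-nat n.
Proof.
move=> n_gt0 nS; apply/pnatP=> // p p_pr p_n.
have [//|/(nS _ p_pr)] := boolP (p \in S).
by move=> /pnatP => /(_ n_gt0 p p_pr p_n); rewrite !inE eqxx.
Qed.

Lemma integers_local x :
  (forall p, prime p -> p \notin S -> x \in integers p^') -> x \in integers S.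
Proof.
move=> xp; rewrite inE; apply: pnat_outside => [|p p_pr pS].
  by rewrite absz_gt0 denq_neq0.
exact: xp.
Qed.

Lemma integers_localize p x :
  p \notin S -> x \in integers S -> x \in integers p^'.
Proof.
move=> pS; rewrite !inE; apply: sub_in_pnat => q _ qS.
by rewrite !inE; apply: contraNneq pS => <-.
Qed.

Lemma int_units_localize p x :
  p \notin S -> x \in int_units S -> x \in int_units p^'.
Proof.
by move=> pS /and3P[x0 xS xVS]; apply/and3P; split=> //;
  apply: (integers_localize pS).
Qed.

Lemma pow_outside (N k : nat) :
  (0 < N)%N -> (0 < k)%N ->
  (forall p, prime p -> p \notin S -> (k %| logn p N)%N) ->
  exists2 m, (0 < m)%N & N%:R / m%:R ^+ k \in int_units S.
Proof.
move=> N_gt0 k_gt0 kN.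
(* [m ^ k] is the part of [N] outside S, so the quotient is the S-part of [N]. *)
pose m := (\prod_(0 <= p < N.+1 | p \in negn S) p ^ (logn p N %/ k))%N.
have mk : (m ^ k)%N = (N`_(negn S))%N.
  rewrite /m (big_morph _ (fun a b => expnMn a b k) (exp1n k)).
  apply: eq_bigr => p pS; rewrite -expnM divnK //.
  have [/kN -> //|/negPf p_npr] := boolP (prime p).
  by rewrite lognE p_npr.
have mk0 : m%:R ^+ k != 0 :> rat.
  by rewrite -natrX mk pnatr_eq0 -lt0n part_gt0.
exists m; first by move: mk0; rewrite expf_eq0 k_gt0 pnatr_eq0 lt0n.
suff -> : N%:R / m%:R ^+ k = (N`_S)%N%:R :> rat by apply/nat_unit/part_pnat.
apply: (canLR (mulfK mk0)).
by rewrite -natrX -natrM mk partnC.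
Qed.

End LocalGlobal.

(** Write the unit as [a / d] with [a], [d] prime to [p], and [v] as [c / f]. Valuations at [p] in
    [N f^n d = |a| c^n], up to signs, give v(N) + n v(f) = n v(c). *)
Lemma logn_unit_factor p n N (v : rat) :
  prime p -> (0 < N)%N -> N%:R / v ^+ n \in int_units p^' ->
  (n %| logn p N)%N.
Proof.
move=> p_pr N_gt0 /and3P[w0 /integersP[d p_d [a def_a]]].
move=> /integersP[e p_e [b def_b]].
have vn0 : v ^+ n != 0 by move: w0; rewrite mulf_eq0 invr_eq0 => /norP[].
have [d_gt0 e_gt0] : (0 < d)%N /\ (0 < e)%N.
  by split; [case/andP: p_d | case/andP: p_e].
(* [b / e] is the inverse of [a / d], so [a b = d e] up to sign, and [a] is prime to [p] because [d]
   and [e] are. *)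
have ab : (`|a| * `|b|)%N = (d * e)%N.
  suff /eqP : (a * b)%:~R = (d%:Z * e%:Z)%:~R :> rat.
    by rewrite eqr_int => /eqP eq_ab; rewrite -abszM eq_ab abszM.
  by rewrite !rmorphM /= -def_a -def_b mulrACA divff ?mul1r.
have p_a : p^'.-nat `|a|%N.
  by apply: (@pnat_dvd _ (d * e)); rewrite -?ab ?dvdn_mulr // ab pnatM p_d.
have [a_gt0 _] : (0 < `|a|)%N /\ (0 < `|b|)%N.
  by apply/andP; rewrite -muln_gt0 ab muln_gt0 d_gt0.
move: vn0 def_a; rewrite -[v]divq_num_den expr_div_n.
have := denq_neq0 v; move: (numq v) (denq v) => c f f0.
rewrite mulf_eq0 invr_eq0 => /norP[cn0 fn0] def_a.
have /(congr1 (logn p)) : (N * `|f| ^ n * d)%N = (`|a| * `|c| ^ n)%N.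
  suff /eqP : (N%:Z * f ^+ n * d%:Z)%:~R = (a * c ^+ n)%:~R :> rat.
    rewrite eqr_int => /eqP /(congr1 absz).
    by rewrite !abszM !abszX.
  rewrite !rmorphM !rmorphXn /= -def_a; field.
  by rewrite cn0 fn0.
have {}cn0 : (0 < `|c| ^ n)%N.
  by move: cn0; rewrite -abszX -rmorphXn intr_eq0 absz_gt0.
have {}fn0 : (0 < `|f| ^ n)%N by rewrite expn_gt0 absz_gt0 f0.
have logn_p' m : p^'.-nat m -> logn p m = 0%N.
  case/andP=> m_gt0 /allP p_m; apply/eqP; rewrite -leqn0 leqNgt logn_gt0.
  by apply/negP=> /p_m; rewrite !inE eqxx.
rewrite !lognM ?muln_gt0 ?N_gt0 ?fn0 // (logn_p' d) // (logn_p' `|a|%N) //.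
rewrite !lognX addn0 add0n => eqN.
by rewrite -(dvdn_addl _ (dvdn_mulr (logn p `|f|) (dvdnn n))) eqN dvdn_mulr.
Qed.

Lemma sign_unit (pi : nat_pred) (b : bool) : (-1) ^+ b \in int_units pi.
Proof.
apply/rpredX/and3P; rewrite oppr_eq0 oner_neq0 invrN1.
by split=> //; rewrite rpredN rpred1.
Qed.

(** The local hypotheses make each exponent outside S divisible by [n]; unique factorization then
    assembles one global [v]. *)
Lemma unit_times_power_outside (S : {fset nat}) (n : nat) (D : rat) :
  (0 < n)%N -> D != 0 ->
  (forall p, prime p -> p \notin S ->
     exists v, D / v ^+ n \in int_units p^') ->
  exists2 v, v != 0 & D / v ^+ n \in int_units S.
Proof.
(* Multiplying [D] by [d ^ n] gives an integer of absolute value [N] (one factor [d] is absorbed by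
   the numerator) and only rescales [v] by [d]. *)
move=> n_gt0 D0 Dp; set d := `|denq D|%N; set N := (`|numq D| * d ^ n.-1)%N.
have d0 : d%:R != 0 :> rat by rewrite pnatr_eq0 absz_eq0 denq_neq0.
have N_gt0 : (0 < N)%N.
  rewrite /N muln_gt0 absz_gt0 numq_eq0 D0 expn_gt0.
  by rewrite absz_gt0 denq_neq0.
have [b def_D] : exists b : bool, D * d%:R ^+ n = (-1) ^+ b * N%:R.
  exists (numq D < 0); rewrite -{1}(prednK n_gt0) exprS mulrA.
  rewrite /N natrM natrX mulrA; congr (_ * _).
  have -> : d%:R = (denq D)%:~R :> rat by rewrite -[denq D]absz_denq.
  by rewrite -numqE [in LHS](intEsign (numq D)) rmorphM rmorph_sign.
have D_N v : D / v ^+ n = (-1) ^+ b * (N%:R / (d%:R * v) ^+ n).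
  have dn0 : d%:R ^+ n != 0 :> rat by rewrite expf_neq0.
  by rewrite mulrA -def_D exprMn invfM mulrA mulfK.
have signE (pi : nat_pred) x :
    ((-1) ^+ b * x \in int_units pi) = (x \in int_units pi).
  apply/idP/idP=> xS; last by rewrite rpredM // sign_unit.
  by rewrite -[x](signrMK b) rpredM // sign_unit.
have [p p_pr pS|m m_gt0 Nm] := @pow_outside S N n N_gt0 n_gt0.
  have [v] := Dp p p_pr pS; rewrite D_N signE; exact: logn_unit_factor.
have m0 : m%:R != 0 :> rat by rewrite pnatr_eq0 -lt0n.
exists (m%:R / d%:R); first by rewrite mulf_neq0 ?invr_eq0.
by rewrite D_N signE mulrCA divff ?mulr1.
Qed.

(** * Models of marked curves *)

Lemma isom_refl m : isom m m.
Proof.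
exists (WChange 1 0 0 0); first exact: oner_neq0.
case: m => [[A1 A2 A3 A4 A6] x y] /=.
by congr (Marked (Weierstrass _ _ _ _ _)); field.
Qed.

Lemma isom_sym m m' : isom m m' -> isom m' m.
Proof.
case=> [[u r s t]] /= u0 <-.
(* The inverse change, from solving x = u^2 x' + r and y = u^3 y' + s u^2 x' + t for x' and y'. *)
exists (WChange u^-1 (- r / u ^+ 2) (- s / u) ((r * s - t) / u ^+ 3)).
  by rewrite invr_eq0.
case: m => [[A1 A2 A3 A4 A6] x y] /=.
by congr (Marked (Weierstrass _ _ _ _ _)); field.
Qed.

Lemma isom_trans m1 m2 m3 : isom m1 m2 -> isom m2 m3 -> isom m1 m3.
Proof.
case=> [[u r s t]] /= u0 <- [[u' r' s' t']] /= u'0 <-.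
exists (WChange (u * u') (r + u ^+ 2 * r') (s + u * s')
                (t + u ^+ 3 * t' + s * u ^+ 2 * r')).
  by rewrite mulf_neq0.
case: m1 => [[A1 A2 A3 A4 A6] x y] /=.
by congr (Marked (Weierstrass _ _ _ _ _)); field; rewrite u0 u'0.
Qed.

(** Negation y -> - y - a1 x - a3 is itself a change of coordinates, with u = -1. *)
Lemma isom_opp m : isom m (opp_point m).
Proof.
exists (WChange (-1) 0 (- a1 (curve m)) (- a3 (curve m))).
  by rewrite oppr_eq0 oner_neq0.
case: m => [[A1 A2 A3 A4 A6] x y] /=.
by congr (Marked (Weierstrass _ _ _ _ _)) => /=; field.
Qed.

(* [-1] is an automorphism of E, so it identifies (E, P) with (E, -P). *)
Lemma isom_pmE m m' : isom_pm m m' <-> isom m m'.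
Proof.
split=> [[//|mm']|]; last by left.
exact: isom_trans mm' (isom_sym (isom_opp m')).
Qed.

(* - c4 / 48 and - c6 / 864 *)
Definition short4 (W : weierstrass) : rat :=
  let b2 := a1 W ^+ 2 + 4 * a2 W in
  let b4 := 2 * a4 W + a1 W * a3 W in
  (24 * b4 - b2 ^+ 2) / (2 ^+ 4 * 3).

Definition short6 (W : weierstrass) : rat :=
  let b2 := a1 W ^+ 2 + 4 * a2 W in
  let b4 := 2 * a4 W + a1 W * a3 W in
  let b6 := a3 W ^+ 2 + 4 * a6 W in
  (b2 ^+ 3 - 36 * b2 * b4 + 216 * b6) / (2 ^+ 5 * 3 ^+ 3).

Lemma short4_change h W :
  cu h != 0 -> short4 (change_curve h W) = short4 W / cu h ^+ 4.
Proof.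
by case: h W => u r s t [A1 A2 A3 A4 A6] /= u0; rewrite /short4 /=; field.
Qed.

Lemma short6_change h W :
  cu h != 0 -> short6 (change_curve h W) = short6 W / cu h ^+ 6.
Proof.
by case: h W => u r s t [A1 A2 A3 A4 A6] /= u0; rewrite /short6 /=; field.
Qed.

(** Here [s] completes the square in y, [r = - b2 / 12] completes the cube in x, and [t] removes
    what is left of a3; [u] stays free, to be fitted to the discriminant. *)
Lemma change_curve_short W u : u != 0 ->
  exists2 h : wchange, cu h = u &
    change_curve h W = short (short4 W / u ^+ 4) (short6 W / u ^+ 6).
Proof.
case: W => A1 A2 A3 A4 A6 u0; pose r := - (A2 + A1 ^+ 2 / 4) / 3.
exists (WChange u r (- A1 / 2) (- (A3 + r * A1) / 2)) => //.
by rewrite /short /short4 /short6 /r /=; congr Weierstrass; field.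
Qed.

(* Purely syntactic, so that no literal of [rat] is ever evaluated. *)
Ltac closure := repeat match goal with
  | H : is_true (?a \in _) |- is_true (?a \in _) => exact: H
  | |- is_true (_ + _ \in _) => apply: rpredD
  | |- is_true (- _ \in _) => rewrite rpredN
  | |- is_true (_ * _ \in _) => apply: rpredM
  | |- is_true (_ ^+ _ \in _) => apply: rpredX
  | |- is_true (_%:R \in _) => exact: rpred_nat
  | |- is_true (1 \in _) => exact: rpred1
  | |- is_true (_^-1 \in _) => first [rewrite rpredV | apply: unit_integerV]
  end.

(** * Integrality where 2 and 3 are units *)

Section Integrality.
Variable pi : nat_pred.
Hypotheses (pi2 : 2 \in int_units pi) (pi3 : 3 \in int_units pi).

Lemma half_integers a : (2 * a \in integers pi) = (a \in integers pi).
Proof.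
have two0 : 2 != 0 :> rat by [].
apply/idP/idP => aS; last by rewrite rpredM // rpred_nat.
by rewrite -[a](mulKf two0) rpredM // unit_integerV.
Qed.

Lemma third_integers a : (3 * a \in integers pi) = (a \in integers pi).
Proof.
have three0 : 3 != 0 :> rat by [].
apply/idP/idP => aS; last by rewrite rpredM // rpred_nat.
by rewrite -[a](mulKf three0) rpredM // unit_integerV.
Qed.

Lemma short_integers W :
  [/\ a1 W \in integers pi, a2 W \in integers pi & a3 W \in integers pi] ->
  a4 W \in integers pi -> a6 W \in integers pi ->
  short4 W \in integers pi /\ short6 W \in integers pi.
Proof.
case: W => A1 A2 A3 A4 A6 [/= S1 S2 S3] S4 S6.
by rewrite /short4 /short6 /=; split; closure.
Qed.

(** Integrality of a point must be tested in every smooth model. If a1', a2', a3' are the new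
    coefficients, 2s = a1' u, 3r = a2' u^2 + s^2 and 2t = a3' u^3 make s, r, t integral in turn. *)
Lemma change_short_integers h A B x y :
  let W := change_curve h (short A B) in let m := Marked (short A B) x y in
  cu h \in int_units pi ->
  [/\ a1 W \in integers pi, a2 W \in integers pi & a3 W \in integers pi] ->
  x \in integers pi -> y \in integers pi ->
  px (change h m) \in integers pi /\ py (change h m) \in integers pi.
Proof.
case: h => u r s t /= uS [S1 S2 S3] xS yS.
have u0 := unit_neq0 uS; have uI := unit_integer uS.
have un0 n : u ^+ n != 0 by rewrite expf_neq0.
have sS : s \in integers pi.
  rewrite -half_integers; have := rpredM S1 uI.
  by rewrite (mulfVK u0) add0r.
have rS : r \in integers pi.
  rewrite -third_integers.
  have := rpredD (rpredM S2 (rpredX 2 uI)) (rpredX 2 sS).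
  by rewrite (mulfVK (un0 _)) mulr0 subr0 add0r subrK.
have tS : t \in integers pi.
  rewrite -half_integers; have := rpredM S3 (rpredX 3 uI).
  by rewrite (mulfVK (un0 _)) mulr0 !add0r.
by split; closure.
Qed.
End Integrality.

(** * Short models over Z_S *)

Section Models.
Variable S : {fset nat}.
Hypotheses (S2 : (2 : nat) \in S) (S3 : (3 : nat) \in S).

Lemma unit2 : 2 \in int_units S.
Proof. apply: (@nat_unit S 2); rewrite pnatE //; exact: S2. Qed.

Lemma unit3 : 3 \in int_units S.
Proof. apply: (@nat_unit S 3); rewrite pnatE //; exact: S3. Qed.

Lemma short_smooth p A B : p \notin S ->
  A \in integers S -> B \in integers S -> wdisc (short A B) \in int_units S ->
  smooth_at p (short A B).
Proof.
move=> pS AS BS DS; split=> //=; try exact: rpred0.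
- exact: integers_localize AS.
- exact: integers_localize BS.
- exact: int_units_localize DS.
Qed.

(** Take [u] with discriminant over [u ^ 12] an S-unit. At p outside S, the scaling factor [cu k] to
    a smooth model differs from [u] by a p-unit, so the short coefficients inherit p-integrality
    from that model. *)
Lemma exists_short_form m : calY S m ->
  exists A4 A6 xt yt : rat, short_form S m A4 A6 xt yt.
Proof.
case: m => W x y [/= D0 _ good _].
have [p p_pr pS|u u0 Du] := @unit_times_power_outside S 12 _ isT D0.
  have [h h0 [_ _ _ Dp]] := good p p_pr pS.
  by exists (cu h); rewrite -wdisc_change.
have [h hu hW] := change_curve_short W u0.
have local p : prime p -> p \notin S ->
    short4 W / u ^+ 4 \in integers p^' /\ short6 W / u ^+ 6 \in integers p^'.
  move=> p_pr pS; have [k k0 [W123 W4 W6 Dk]] := good p p_pr pS.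
  (* The 12th power of this ratio is a quotient of two discriminants that are units at [p]. *)
  have k_u : cu k / u \in integers p^'.
    apply/unit_integer/(@unit_root _ 12) => //.
    have := rpred_div (int_units_localize pS Du) Dk.
    have -> : (cu k / u) ^+ 12
              = (wdisc W / u ^+ 12) / wdisc (change_curve k W).
      by rewrite wdisc_change //; field; rewrite u0 k0 D0.
    by rewrite rpred_div // (int_units_localize pS).
  have [] := short_integers (int_units_localize pS unit2)
                            (int_units_localize pS unit3) W123 W4 W6.
  rewrite short4_change // short6_change // => I4 I6; split.
    have -> : short4 W / u ^+ 4 = short4 W / cu k ^+ 4 * (cu k / u) ^+ 4.
      by field; rewrite u0 k0.
    by rewrite rpredM // rpredX.
  have -> : short6 W / u ^+ 6 = short6 W / cu k ^+ 6 * (cu k / u) ^+ 6.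
    by field; rewrite u0 k0.
  by rewrite rpredM // rpredX.
exists (short4 W / u ^+ 4), (short6 W / u ^+ 6).
exists (px (change h (Marked W x y))), (py (change h (Marked W x y))).
split.
- by apply: integers_local => p p_pr /(local p p_pr)[].
- by apply: integers_local => p p_pr /(local p p_pr)[].
- by rewrite -hW wdisc_change hu.
- by exists h; rewrite ?hu // -hW; case: (h).
Qed.

(** The short model is itself smooth at each p outside S, so [integral_outside] applies to it
    directly. *)
Lemma short_form_integers m A4 A6 x y :
  calY S m -> short_form S m A4 A6 x y ->
  x \in integers S /\ y \in integers S.
Proof.
move=> [_ _ _ mS] [A4S A6S DS [h h0 hm]].
have local p : prime p -> p \notin S ->
    x \in integers p^' /\ y \in integers p^'.
  move=> p_pr pS; have := mS p h p_pr pS h0.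
  have -> : change_curve h (curve m) = curve (change h m) by case: (h).
  rewrite hm; apply; exact: short_smooth.
by split; apply: integers_local => p p_pr /(local p p_pr)[].
Qed.

Lemma calY_short A B x y :
  A \in integers S -> B \in integers S ->
  x \in integers S -> y \in integers S ->
  wdisc (short A B) \in int_units S -> y ^+ 2 = x ^+ 3 + A * x + B ->
  calY S (Marked (short A B) x y).
Proof.
move=> AS BS xS yS DS xy; split=> /=.
- exact: unit_neq0 DS.
- by rewrite /on_curve /= xy; ring.
- move=> p p_pr pS; exists (WChange 1 0 0 0); first exact: oner_neq0.
  have -> : change_curve (WChange 1 0 0 0) (short A B) = short A B.
    by rewrite /short /=; congr Weierstrass; field.
  exact: short_smooth.
- move=> p h p_pr pS h0 [W123 _ _]; rewrite wdisc_change // => Dh.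
  (* Both models have p-unit discriminants, and [cu h ^ 12] is their ratio. *)
  have uS : cu h \in int_units p^'.
    apply: (@unit_root _ 12) => //.
    have -> : cu h ^+ 12 = wdisc (short A B) / (wdisc (short A B) / cu h ^+ 12).
      by rewrite invf_div mulrC mulfVK // (unit_neq0 DS).
    by rewrite rpred_div // (int_units_localize pS).
  exact: (change_short_integers (int_units_localize pS unit2)
    (int_units_localize pS unit3) uS W123 (integers_localize pS xS)
    (integers_localize pS yS)).
Qed.

Lemma on_curve_isom m m' : isom m m' -> on_curve m -> on_curve m'.
Proof. by case=> h h0 <-; rewrite on_curve_change. Qed.
End Models.

(** * Substitutions in binary quartics *)

Lemma comp_mpolyA (n m k : nat) (R : comNzRingType) (p : {mpoly R[n]})
    (lp : n.-tuple {mpoly R[m]}) (lq : m.-tuple {mpoly R[k]}) :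
  (p \mPo lp) \mPo lq = p \mPo [tuple tnth lp i \mPo lq | i < n].
Proof.
rewrite (comp_mpolyE p lp) (comp_mpolyE p) raddf_sum; apply: eq_bigr => m' _.
rewrite /= comp_mpolyZ rmorph_prod; congr (_ *: _); apply: eq_bigr => i _.
by rewrite rmorphXn tnth_mktuple.
Qed.

Lemma bact_u g : bact g bu = g 0 0 *: bu + g 0 1 *: bv.
Proof. by rewrite /bact /bu comp_mpolyXU -tnth_nth tnth_mktuple. Qed.

Lemma bact_v g : bact g bv = g 1 0 *: bu + g 1 1 *: bv.
Proof.
rewrite /bact {1}/bv comp_mpolyXU -tnth_nth tnth_mktuple.
by rewrite (_ : ord_max = 1) //; apply: val_inj.
Qed.

Lemma bactZ g a F : bact g (a *: F) = a *: bact g F.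
Proof. exact: comp_mpolyZ. Qed.

Lemma bactM g h F : bact g (bact h F) = bact (h *m g) F.
Proof.
rewrite /bact comp_mpolyA; congr comp_mpoly; apply: eq_from_tnth => i.
rewrite !tnth_mktuple comp_mpolyD !comp_mpolyZ.
rewrite -!/(bact _ _) bact_u bact_v !mxE !big_ord_recl !big_ord0 !addr0.
have -> : lift ord0 ord0 = 1 :> 'I_2 by apply: val_inj.
rewrite -!mul_mpolyC; ring.
Qed.

Lemma bact1 F : bact 1%:M F = F.
Proof.
rewrite -[RHS]comp_mpoly_id /bact; congr comp_mpoly.
apply: eq_from_tnth => i; rewrite !tnth_mktuple !mxE /bu /bv.
case: i => [[|[|//]] lt_i] /=; rewrite ?scale1r ?scale0r ?addr0 ?add0r.
  by congr 'X_ _; apply: val_inj.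
by congr 'X_ _; apply: val_inj.
Qed.

(** A degree 4 [bform] with its coefficients as plain arguments, so that identities become
    accessible to [ring]. *)
Definition quartic (c0 c1 c2 c3 c4 : rat) : {mpoly rat[2]} :=
  c0 *: bu ^+ 4 + c1 *: (bu ^+ 3 * bv) + c2 *: (bu ^+ 2 * bv ^+ 2)
  + c3 *: (bu * bv ^+ 3) + c4 *: bv ^+ 4.

Definition quartic_I (c0 c1 c2 c3 c4 : rat) : rat :=
  12 * c0 * c4 - 3 * c1 * c3 + c2 ^+ 2.

Definition quartic_J (c0 c1 c2 c3 c4 : rat) : rat :=
  72 * c0 * c2 * c4 + 9 * c1 * c2 * c3 - 27 * c0 * c3 ^+ 2
  - 27 * c4 * c1 ^+ 2 - 2 * c2 ^+ 3.

Lemma quartic_discE c0 c1 c2 c3 c4 :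
  quartic_disc c0 c1 c2 c3 c4 =
  (4 * quartic_I c0 c1 c2 c3 c4 ^+ 3 - quartic_J c0 c1 c2 c3 c4 ^+ 2) / 27.
Proof. by []. Qed.

(* The coefficients of Q(p u + r v, s u + t v). *)
Section SubstitutedCoefficients.
Variables p r s t c0 c1 c2 c3 c4 : rat.

Definition subst0 := c0 * p ^+ 4 + c1 * p ^+ 3 * s + c2 * p ^+ 2 * s ^+ 2
  + c3 * p * s ^+ 3 + c4 * s ^+ 4.

Definition subst1 := 4 * c0 * p ^+ 3 * r
  + c1 * (p ^+ 3 * t + 3 * p ^+ 2 * r * s)
  + c2 * (2 * p ^+ 2 * s * t + 2 * p * r * s ^+ 2)
  + c3 * (3 * p * s ^+ 2 * t + r * s ^+ 3) + 4 * c4 * s ^+ 3 * t.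

Definition subst2 := 6 * c0 * p ^+ 2 * r ^+ 2
  + c1 * (3 * p ^+ 2 * r * t + 3 * p * r ^+ 2 * s)
  + c2 * (p ^+ 2 * t ^+ 2 + 4 * p * r * s * t + r ^+ 2 * s ^+ 2)
  + c3 * (3 * p * s * t ^+ 2 + 3 * r * s ^+ 2 * t) + 6 * c4 * s ^+ 2 * t ^+ 2.

Definition subst3 := 4 * c0 * p * r ^+ 3
  + c1 * (3 * p * r ^+ 2 * t + r ^+ 3 * s)
  + c2 * (2 * p * r * t ^+ 2 + 2 * r ^+ 2 * s * t)
  + c3 * (p * t ^+ 3 + 3 * r * s * t ^+ 2) + 4 * c4 * s * t ^+ 3.

Definition subst4 := c0 * r ^+ 4 + c1 * r ^+ 3 * t + c2 * r ^+ 2 * t ^+ 2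
  + c3 * r * t ^+ 3 + c4 * t ^+ 4.

(** The invariants I and J are multiplied by the 4th and 6th powers of the determinant, so [I ^ 3]
    and [J ^ 2] both by the 12th. Treating I and J apart avoids expanding the whole discriminant. *)
Lemma quartic_disc_subst :
  quartic_disc subst0 subst1 subst2 subst3 subst4 =
  (p * t - r * s) ^+ 12 * quartic_disc c0 c1 c2 c3 c4.
Proof.
rewrite !quartic_discE.
have -> : quartic_I subst0 subst1 subst2 subst3 subst4 =
          (p * t - r * s) ^+ 4 * quartic_I c0 c1 c2 c3 c4.
  by rewrite /quartic_I /subst0 /subst1 /subst2 /subst3 /subst4; ring.
have -> : quartic_J subst0 subst1 subst2 subst3 subst4 =
          (p * t - r * s) ^+ 6 * quartic_J c0 c1 c2 c3 c4.
  by rewrite /quartic_J /subst0 /subst1 /subst2 /subst3 /subst4; ring.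
by move: (quartic_I _ _ _ _ _) (quartic_J _ _ _ _ _) => I J; field.
Qed.
End SubstitutedCoefficients.

Lemma bact_quartic (g : 'M[rat]_2) c0 c1 c2 c3 c4 :
  let p := g 0 0 in let r := g 0 1 in let s := g 1 0 in let t := g 1 1 in
  bact g (quartic c0 c1 c2 c3 c4) =
  quartic (subst0 p s c0 c1 c2 c3 c4) (subst1 p r s t c0 c1 c2 c3 c4)
          (subst2 p r s t c0 c1 c2 c3 c4) (subst3 p r s t c0 c1 c2 c3 c4)
          (subst4 r t c0 c1 c2 c3 c4).
Proof.
move=> p r s t.
have bactX a b i j :
    bact g (a ^+ i * b ^+ j) = bact g a ^+ i * bact g b ^+ j.
  by rewrite /bact -!rmorphXn -rmorphM.
have bactXl a i : bact g (a ^+ i) = bact g a ^+ i by rewrite /bact -rmorphXn.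
rewrite /quartic [LHS]/bact !comp_mpolyD !comp_mpolyZ -!/(bact _ _).
rewrite !bactXl (bactX _ _ 3 1) (bactX _ _ 2 2) (bactX _ _ 1 3) bact_u bact_v.
rewrite /subst0 /subst1 /subst2 /subst3 /subst4 -/p -/r -/s -/t.
by rewrite !expr1 -!mul_mpolyC; ring.
Qed.

Lemma quarticZ a c0 c1 c2 c3 c4 :
  a *: quartic c0 c1 c2 c3 c4 =
  quartic (a * c0) (a * c1) (a * c2) (a * c3) (a * c4).
Proof. by rewrite /quartic !scalerDr !scalerA. Qed.

Lemma meval_bu x y : bu.@[point2 x y] = x.
Proof. by rewrite mevalXU. Qed.

Lemma meval_bv x y : bv.@[point2 x y] = y.
Proof. by rewrite mevalXU. Qed.

Lemma meval_quartic c0 c1 c2 c3 c4 x y :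
  (quartic c0 c1 c2 c3 c4).@[point2 x y] =
  c0 * x ^+ 4 + c1 * (x ^+ 3 * y) + c2 * (x ^+ 2 * y ^+ 2) + c3 * (x * y ^+ 3)
  + c4 * y ^+ 4.
Proof.
have evalX (a b : {mpoly rat[2]}) i j v :
    (a ^+ i * b ^+ j).@[v] = a.@[v] ^+ i * b.@[v] ^+ j.
  by rewrite -!rmorphXn -rmorphM.
have evalXl (a : {mpoly rat[2]}) i v : (a ^+ i).@[v] = a.@[v] ^+ i.
  by rewrite -rmorphXn.
rewrite /quartic !mevalD !mevalZ !evalXl.
by rewrite (evalX _ _ 3 1) (evalX _ _ 2 2) (evalX _ _ 1 3) meval_bu meval_bv.
Qed.

(** A binary quartic is determined by its values at vectors over five distinct points of the
    projective line. *)
Lemma quartic_inj c0 c1 c2 c3 c4 d0 d1 d2 d3 d4 :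
  quartic c0 c1 c2 c3 c4 = quartic d0 d1 d2 d3 d4 ->
  [/\ c0 = d0, c1 = d1, c2 = d2, c3 = d3 & c4 = d4].
Proof.
move=> eq_cd.
have E x y := congr1 (fun F => F.@[point2 x y]) eq_cd.
have /= := (E 1 0, E 0 1, E 1 1, E 1 (-1), E 1 2).
by rewrite !meval_quartic => -[[[[]]]] *; split; lra.
Qed.

Lemma bform_quartic (c : 'rV[rat]_5) :
  bform c = quartic (c 0 (inord 0)) (c 0 (inord 1)) (c 0 (inord 2))
                    (c 0 (inord 3)) (c 0 (inord 4)).
Proof.
rewrite /bform !big_ord_recl big_ord0 /quartic addr0 !addrA.
rewrite /= /bump /= !subSS !subn0 ?subnn expr0 expr1 ?mulr1 ?mul1r.
by congr (c 0 _ *: _ + c 0 _ *: _ + c 0 _ *: _ + c 0 _ *: _ + c 0 _ *: _);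
  apply: val_inj; rewrite /= inordK.
Qed.

Lemma bform_linear (b : 'rV[rat]_2) : bform b = b 0 0 *: bu + b 0 1 *: bv.
Proof.
rewrite /bform !big_ord_recl big_ord0 addr0 /= expr0 expr1 mulr1 mul1r.
by congr (_ + b 0 _ *: _); apply: val_inj.
Qed.

Lemma kappa_pairE A x y :
  kappa_pair A x y =
  (bv, quartic 1 0 (- (6 * x)) (- (8 * y)) (- (3 * x ^+ 2 + 4 * A))).
Proof. by rewrite /kappa_pair /quartic scale1r scale0r addr0 !scaleNr. Qed.

(** With a6 eliminated through the curve equation, this is a polynomial identity in [A], [x],
    [y]. *)
Lemma kappa_disc A x y :
  quartic_disc 1 0 (- (6 * x)) (- (8 * y)) (- (3 * x ^+ 2 + 4 * A)) =
  2 ^+ 8 * wdisc (short A (y ^+ 2 - x ^+ 3 - A * x)).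
Proof. by rewrite /quartic_disc /wdisc /=; field. Qed.

Lemma det_mx22 (A : 'M[rat]_2) : \det A = A 0 0 * A 1 1 - A 0 1 * A 1 0.
Proof.
rewrite (expand_det_row _ ord0) !big_ord_recl big_ord0 /cofactor !det_mx11.
rewrite !mxE /= expr0 expr1 addr0 mul1r mulN1r mulrN.
by congr (A _ _ * A _ _ - A _ _ * A _ _); apply: val_inj.
Qed.

Definition mat2 (p r s t : rat) : 'M[rat]_2 :=
  \matrix_(i, j) nth 0 (nth [::] [:: [:: p; r]; [:: s; t]] i) j.

Lemma mat2E p r s t : ((mat2 p r s t 0 0 = p) * (mat2 p r s t 0 1 = r) *
  (mat2 p r s t 1 0 = s) * (mat2 p r s t 1 1 = t))%type.
Proof. by rewrite !mxE. Qed.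

Lemma det_mat2 p r s t : \det (mat2 p r s t) = p * t - r * s.
Proof. by rewrite det_mx22 !mat2E. Qed.

(** * Equivalence of pairs of forms over Z_S *)

Section GL2.
Variable S : {fset nat}.

Lemma det_integers n (A : 'M[rat]_n) :
  A \is a mxOver (integers S) -> \det A \in integers S.
Proof.
move=> /mxOverP AS; rewrite /determinant rpred_sum // => s _.
by rewrite rpredM ?rpred_prod // rpredX // rpredN rpred1.
Qed.

(** Cramer's rule: the adjugate has integral entries, and the determinant is a unit. *)
Lemma invmx_integers n (A : 'M[rat]_n) :
  A \is a mxOver (integers S) -> \det A \in int_units S ->
  invmx A \is a mxOver (integers S).
Proof.
move=> AS dS; have dn0 := unit_neq0 dS.
rewrite /invmx unitmxE unitfE dn0; apply/mxOverP => i j; rewrite !mxE.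
rewrite rpredM ?unit_integerV // rpredM // ?rpredX ?rpredN ?rpred1 //.
by apply: det_integers; apply/mxOverP=> k l; rewrite !mxE; apply/mxOverP.
Qed.

Lemma GL2_equiv_refl F : GL2_equiv S F F.
Proof.
by case: F => L Q; exists 1%:M, 1, 1; rewrite det1 rpred1 !bact1 !scale1r.
Qed.

Lemma GL2_equiv_sym F F' : GL2_equiv S F F' -> GL2_equiv S F' F.
Proof.
case: F F' => [L Q] [L' Q'] [g [l1 [l2 [[gS dS] l1S l2S /= [eqL eqQ]]]]].
have gu : g \in unitmx by rewrite unitmxE unitfE (unit_neq0 dS).
have inv (l : rat) (F F' : {mpoly rat[2]}) : l \in int_units S ->
    bact g F = l *: F' -> bact (invmx g) F' = l^-1 *: F.
  move=> lS eqF; have l0 := unit_neq0 lS.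
  by rewrite -[F'](scalerK l0) -eqF bactZ bactM mulmxV // bact1.
exists (invmx g), l1^-1, l2^-1; rewrite !rpredV /= det_inv rpredV.
split=> //; first by split=> //; exact: invmx_integers.
by rewrite (inv l1 L L') // (inv l2 Q Q').
Qed.

Lemma GL2_equiv_trans F1 F2 F3 :
  GL2_equiv S F1 F2 -> GL2_equiv S F2 F3 -> GL2_equiv S F1 F3.
Proof.
case: F1 F2 F3 => [L1 Q1] [L2 Q2] [L3 Q3].
move=> [g [l1 [l2 [[gS dS] l1S l2S /= [eqL eqQ]]]]].
move=> [h [k1 [k2 [[hS eS] k1S k2S /= [eqL' eqQ']]]]].
exists (g *m h), (l1 * k1), (l2 * k2); rewrite !rpredM //; split=> //.
  by rewrite det_mulmx rpredM.
by rewrite -!bactM /= eqL eqQ !bactZ eqL' eqQ' !scalerA.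
Qed.

(** Reduces an equivalence to scalar equations between coefficients: two for the linear form, five
    for the quartic. *)
Lemma GL2_equiv_subst p r s t l1 l2 b0 b1 b0' b1'
    c0 c1 c2 c3 c4 d0 d1 d2 d3 d4 :
  [/\ p \in integers S, r \in integers S, s \in integers S &
      t \in integers S] ->
  p * t - r * s \in int_units S -> l1 \in int_units S -> l2 \in int_units S ->
  b0 * p + b1 * s = l1 * b0' -> b0 * r + b1 * t = l1 * b1' ->
  [/\ subst0 p s c0 c1 c2 c3 c4 = l2 * d0,
      subst1 p r s t c0 c1 c2 c3 c4 = l2 * d1,
      subst2 p r s t c0 c1 c2 c3 c4 = l2 * d2,
      subst3 p r s t c0 c1 c2 c3 c4 = l2 * d3 &
      subst4 r t c0 c1 c2 c3 c4 = l2 * d4] ->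
  GL2_equiv S (b0 *: bu + b1 *: bv, quartic c0 c1 c2 c3 c4)
              (b0' *: bu + b1' *: bv, quartic d0 d1 d2 d3 d4).
Proof.
move=> [pS rS sS tS] dS l1S l2S eb0 eb1 [e0 e1 e2 e3 e4].
exists (mat2 p r s t), l1, l2; rewrite det_mat2; split=> //.
  split=> //; apply/mxOverP => i j; rewrite mxE.
  by case: i j => [[|[|//]] ?] [[|[|//]] ?].
rewrite bact_quartic !mat2E e0 e1 e2 e3 e4 quarticZ; congr (_, _).
rewrite /bact comp_mpolyD !comp_mpolyZ -!/(bact _ _) bact_u bact_v !mat2E.
rewrite [RHS]scalerDr !scalerA -eb0 -eb1 !scalerDr !scalerA !scalerDl.
by rewrite addrACA.
Qed.

Lemma kappa_subst A x y u :
  u \in int_units S ->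
  GL2_equiv S (kappa_pair A x y)
              (kappa_pair (A / u ^+ 4) (x / u ^+ 2) (y / u ^+ 3)).
Proof.
move=> uS; have u0 := unit_neq0 uS; rewrite !kappa_pairE.
have -> : bv = 0 *: bu + 1 *: bv by rewrite scale0r add0r scale1r.
(* The matrix diag(u, 1) fixes the linear form v and gives the quartic leading coefficient [u ^ 4],
   which is the factor split off. *)
apply: (@GL2_equiv_subst u 0 0 1 1 (u ^+ 4)).
- by rewrite rpred0 rpred1 unit_integer.
- by rewrite mulr1 mulr0 subr0.
- exact: rpred1.
- exact: rpredX.
- by ring.
- by ring.
- by rewrite /subst0 /subst1 /subst2 /subst3 /subst4; split; field.
Qed.

(** Preserving v up to a scalar forces [g 1 0 = 0]; the missing u^3 v terms force [g 0 1 = 0];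
    leading coefficients give [l2 = g 0 0 ^ 4]. The remaining diag(p, t) acts through [p / t]. *)
Lemma kappa_equiv_inj A x y A' x' y' :
  GL2_equiv S (kappa_pair A x y) (kappa_pair A' x' y') ->
  exists2 u, u != 0 & [/\ A' = A / u ^+ 4, x' = x / u ^+ 2 & y' = y / u ^+ 3].
Proof.
rewrite !kappa_pairE => -[g [l1 [l2 [[_ dS] _ l2S /= []]]]].
(* At (1, 0) any multiple of v vanishes, which isolates [g 1 0]. *)
rewrite bact_v => /(congr1 (fun F => F.@[point2 1 0])).
rewrite mevalD !mevalZ meval_bu meval_bv !mulr0 mulr1 addr0 => g10.
move: (unit_neq0 dS); rewrite det_mx22 g10 mulr0 subr0 mulf_eq0.
move=> /norP[g00 g11]; rewrite bact_quartic quarticZ g10 => /quartic_inj[].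
rewrite /subst0 /subst1 /subst2 /subst3 /subst4.
move: (g 0 0) (g 0 1) (g 1 1) g00 g11 => p r t p0 t0.
move=> e0 e1.
have {e1} r0 : r = 0.
  have p3 : 4 * p ^+ 3 != 0 by rewrite mulf_neq0 ?expf_neq0.
  by apply: (mulfI p3); rewrite mulr0 -(mulr0 l2) -e1; ring.
have {e0} <- : p ^+ 4 = l2 by rewrite -(mulr1 l2) -e0; ring.
rewrite r0 => e2 e3 e4.
have ex : x' = x / (p / t) ^+ 2.
  have -> : x' = - (p ^+ 4 * - (6 * x')) / (6 * p ^+ 4) by field.
  by rewrite -e2; field; rewrite p0 t0.
have ey : y' = y / (p / t) ^+ 3.
  have -> : y' = - (p ^+ 4 * - (8 * y')) / (8 * p ^+ 4) by field.
  by rewrite -e3; field; rewrite p0 t0.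
exists (p / t); first by rewrite mulf_neq0 ?invr_eq0.
split=> //.
have -> : A' =
    (- (p ^+ 4 * - (3 * x' ^+ 2 + 4 * A')) / p ^+ 4 - 3 * x' ^+ 2) / 4.
  by field.
by rewrite -e4 ex; field; rewrite p0 t0.
Qed.
End GL2.

(** * The correspondence *)

Lemma unimodular_entry pi n (c : 'rV[rat]_n) i : c 0 i = 1 -> unimodular pi c.
Proof.
move=> ci; exists (delta_mx i 0).
  by apply/mxOverP => j k; rewrite mxE rpred_nat.
by rewrite -colE; apply/matrixP => j k; rewrite !ord1 !mxE ci.
Qed.

Lemma quartic_discZ a c0 c1 c2 c3 c4 :
  quartic_disc (a * c0) (a * c1) (a * c2) (a * c3) (a * c4) =
  a ^+ 6 * quartic_disc c0 c1 c2 c3 c4.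
Proof. by rewrite /quartic_disc; field. Qed.

Section Correspondence.
Variable S : {fset nat}.
Hypotheses (S2 : (2 : nat) \in S) (S3 : (3 : nat) \in S).

Lemma unit_two_three i j : 2 ^+ i * 3 ^+ j \in int_units S.
Proof. by rewrite rpredM ?rpredX ?unit2 ?unit3. Qed.

(** Since L = v, the quartic is evaluated at (-1, 0), where it equals 1; what remains is
    [kappa_disc]. *)
Lemma admissible_kappa A B x y :
  A \in integers S -> x \in integers S -> y \in integers S ->
  wdisc (short A B) \in int_units S -> y ^+ 2 = x ^+ 3 + A * x + B ->
  admissible S (kappa_pair A x y).
Proof.
move=> AS xS yS DS xy.
pose b : 'rV[rat]_2 := delta_mx 0 1.
pose c : 'rV[rat]_5 := \row_i
  nth 0 [:: 1; 0; - (6 * x); - (8 * y); - (3 * x ^+ 2 + 4 * A)] i.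
have cE i : (i < 5)%N -> c 0 (inord i) =
    nth 0 [:: 1; 0; - (6 * x); - (8 * y); - (3 * x ^+ 2 + 4 * A)] i.
  by move=> lt_i; rewrite mxE inordK.
have bE : ((b 0 0 = 0) * (b 0 1 = 1))%type by rewrite !mxE.
exists b, c; split.
- rewrite kappa_pairE bform_linear bform_quartic !bE !cE //.
  by rewrite scale0r add0r scale1r.
- split; last exact: (@unimodular_entry _ _ b 1 bE.2).
  by apply/mxOverP => i j; rewrite mxE; apply: rpred_nat.
- split; last by apply: (@unimodular_entry _ _ c (inord 0)); rewrite cE.
  apply/mxOverP => i [j lt_j]; rewrite mxE /=.
  by case: j lt_j => [|[|[|[|[|//]]]]] _ /=; closure; apply: rpred0.
- rewrite /form_disc !cE //= bform_quartic meval_quartic !cE // !bE /=.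
  rewrite kappa_disc.
  have -> : y ^+ 2 - x ^+ 3 - A * x = B by rewrite xy; ring.
  set q := (X in X ^+ 2); have -> : q = 1 by rewrite /q; ring.
  by rewrite expr1n mulr1 rpredM ?rpredX ?unit2.
Qed.

(** As a1, a2, a3 vanish in both models, s = r = t = 0, and only the scaling by [u] of [kappa_subst]
    is left. *)
Lemma GL2_equiv_of_isom A B x y A' B' x' y' :
  wdisc (short A B) \in int_units S -> wdisc (short A' B') \in int_units S ->
  isom (Marked (short A B) x y) (Marked (short A' B') x' y') ->
  GL2_equiv S (kappa_pair A x y) (kappa_pair A' x' y').
Proof.
move=> DS DS' [h h0 hm].
have uS : cu h \in int_units S.
  apply: (@unit_root _ 12) => //.
  have -> : cu h ^+ 12 = wdisc (short A B) / (wdisc (short A B) / cu h ^+ 12).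
    by rewrite invf_div mulrC mulfVK // (unit_neq0 DS).
  rewrite rpred_div // -wdisc_change //.
  have -> : change_curve h (short A B) =
      curve (change h (Marked (short A B) x y)).
    by case: (h).
  by rewrite hm.
have := kappa_subst A x y uS.
case: h h0 hm {uS} => u r s t /= u0 [e1 e2 e3 eA eB ex ey].
have two0 : 2 / u != 0 by rewrite mulf_neq0 ?invr_eq0.
have s0 : s = 0.
  by apply: (mulfI two0); rewrite mulr0 -e1; field.
have three0 : 3 / u ^+ 2 != 0 by rewrite mulf_neq0 ?invr_eq0 ?expf_neq0.
have r0 : r = 0.
  by apply: (mulfI three0); rewrite mulr0 -e2 s0; field.
have two3 : 2 / u ^+ 3 != 0 by rewrite mulf_neq0 ?invr_eq0 ?expf_neq0.
have t0 : t = 0.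
  by apply: (mulfI two3); rewrite mulr0 -e3 r0; field.
have -> : A / u ^+ 4 = A' by rewrite -eA s0 r0 t0; field.
have -> : x / u ^+ 2 = x' by rewrite -ex r0; field.
by have -> : y / u ^+ 3 = y' by rewrite -ey s0 r0 t0; field.
Qed.

(** The coefficient a6 is absent from [kappa_pair]; the curve equations recover it from [A], [x],
    [y], with weight 6. *)
Lemma isom_of_GL2_equiv A B x y A' B' x' y' :
  on_curve (Marked (short A B) x y) -> on_curve (Marked (short A' B') x' y') ->
  GL2_equiv S (kappa_pair A x y) (kappa_pair A' x' y') ->
  isom (Marked (short A B) x y) (Marked (short A' B') x' y').
Proof.
rewrite /on_curve /= => xy xy' /kappa_equiv_inj[u u0 [eA ex ey]].
exists (WChange u 0 0 0) => //=.
have eB : B' = B / u ^+ 6.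
  have -> : B' = y' ^+ 2 - x' ^+ 3 - A' * x' by ring: xy'.
  have -> : B = y ^+ 2 - x ^+ 3 - A * x by ring: xy.
  by rewrite eA ex ey; field.
by rewrite eA eB ex ey; congr (Marked (Weierstrass _ _ _ _ _)); field.
Qed.

Lemma four_unit : 4 \in int_units S.
Proof.
by have -> : 4 = 2 ^+ 2 * 3 ^+ 0 :> rat by []; apply: unit_two_three.
Qed.

Lemma six_unit : 6 \in int_units S.
Proof.
by have -> : 6 = 2 ^+ 1 * 3 ^+ 1 :> rat by []; apply: unit_two_three.
Qed.

Lemma eight_unit : 8 \in int_units S.
Proof.
by have -> : 8 = 2 ^+ 3 * 3 ^+ 0 :> rat by []; apply: unit_two_three.
Qed.

Lemma twenty_seven_unit : 27 \in int_units S.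
Proof.
by have -> : 27 = 2 ^+ 0 * 3 ^+ 3 :> rat by []; apply: unit_two_three.
Qed.

(** The translation u -> u - (e1 / 4) v removes the u^3 v term, fixes v, and has determinant 1,
    hence preserves the discriminant. *)
Lemma depress_quartic e1 e2 e3 e4 :
  [/\ e1 \in integers S, e2 \in integers S, e3 \in integers S &
      e4 \in integers S] ->
  exists f2 f3 f4,
    [/\ f2 \in integers S, f3 \in integers S, f4 \in integers S,
        quartic_disc 1 0 f2 f3 f4 = quartic_disc 1 e1 e2 e3 e4 &
        GL2_equiv S (0 *: bu + 1 *: bv, quartic 1 e1 e2 e3 e4)
                    (0 *: bu + 1 *: bv, quartic 1 0 f2 f3 f4)].
Proof.
move=> [e1S e2S e3S e4S]; have u4 := four_unit.
have [r rS er] : exists2 r, r \in integers S & r = - e1 / 4.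
  by exists (- e1 / 4); first by closure.
have s0 : subst0 1 0 1 e1 e2 e3 e4 = 1 by rewrite /subst0; ring.
have s1 : subst1 1 r 0 1 1 e1 e2 e3 e4 = 0 by rewrite /subst1 er; field.
exists (subst2 1 r 0 1 1 e1 e2 e3 e4), (subst3 1 r 0 1 1 e1 e2 e3 e4).
exists (subst4 r 1 1 e1 e2 e3 e4); split.
- by rewrite /subst2; closure; apply: rpred0.
- by rewrite /subst3; closure; apply: rpred0.
- by rewrite /subst4; closure; apply: rpred0.
- have := quartic_disc_subst 1 r 0 1 1 e1 e2 e3 e4.
  by rewrite s0 s1 mulr0 subr0 mulr1 expr1n mul1r.
apply: (@GL2_equiv_subst _ 1 r 0 1 1 1).
- by split.
- by rewrite mulr0 subr0 mulr1; exact: rpred1.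
- exact: rpred1.
- exact: rpred1.
- by ring.
- by ring.
- by rewrite s0 s1 !mul1r.
Qed.

(** Once the quartic is depressed, its coefficients - 6x, - 8y and - (3x^2 + 4A) are solved in turn
    for x, y, A, as 6, 8, 4 are S-units; B is then defined by the curve equation. *)
Lemma monic_equiv_kappa e1 e2 e3 e4 :
  [/\ e1 \in integers S, e2 \in integers S, e3 \in integers S &
      e4 \in integers S] ->
  quartic_disc 1 e1 e2 e3 e4 \in int_units S ->
  exists A B x y, [/\ A \in integers S, B \in integers S, x \in integers S &
    y \in integers S] /\ [/\ wdisc (short A B) \in int_units S,
     y ^+ 2 = x ^+ 3 + A * x + B &
     GL2_equiv S (0 *: bu + 1 *: bv, quartic 1 e1 e2 e3 e4)
                 (kappa_pair A x y)].
Proof.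
move=> /depress_quartic[f2 [f3 [f4 [f2S f3S f4S <- equiv]]]] fu.
have solve (a f z : rat) : a \in int_units S -> f \in integers S ->
    z \in integers S -> exists2 w, w \in integers S & f = - (z + a * w).
  move=> au fS zS; have a0 := unit_neq0 au.
  by exists (- (f + z) / a); [closure | field].
have [x xS] := solve 6 f2 0 six_unit f2S (rpred0 _); rewrite add0r => ex.
have [y yS] := solve 8 f3 0 eight_unit f3S (rpred0 _); rewrite add0r => ey.
have xxS : 3 * x ^+ 2 \in integers S by closure.
have [A AS eA] := solve 4 f4 (3 * x ^+ 2) four_unit f4S xxS.
have [B BS eB] : exists2 B, B \in integers S & B = y ^+ 2 - x ^+ 3 - A * x.
  by exists (y ^+ 2 - x ^+ 3 - A * x); first by closure.
move: fu equiv; rewrite {}ex {}ey {}eA kappa_disc -eB => fu equiv.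
exists A, B, x, y; split; first by split.
split.
- rewrite -[wdisc _](mulKf (unit_neq0 (unit_two_three 8 0))) expr0 mulr1.
  by apply: rpredM fu; rewrite rpredV; apply: rpredX; apply: unit2.
- by rewrite eB; ring.
- by move: equiv; rewrite kappa_pairE scale0r add0r scale1r.
Qed.

(** Bezout coefficients d0, d1 of b0, b1 complete the column (-b1, b0) to a matrix of determinant
    -1. It carries L to v, and the leading coefficient of Q becomes the unit Q(-b1, b0), which can
    be divided out. *)
Lemma admissible_equiv_kappa F : admissible S F ->
  exists A B x y, [/\ A \in integers S, B \in integers S, x \in integers S &
    y \in integers S] /\ [/\ wdisc (short A B) \in int_units S,
     y ^+ 2 = x ^+ 3 + A * x + B & GL2_equiv S F (kappa_pair A x y)].
Proof.
(* The formula for [quartic_disc] divides by 27. *)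
have u27 := twenty_seven_unit.
case=> b [c [-> [bS [d dS bd]] [cS _]]]; move: cS bS dS.
move=> /mxOverP cS /mxOverP bS /mxOverP dS.
move/matrixP/(_ 0 0): bd; rewrite !mxE !big_ord_recl big_ord0 addr0 /=.
have -> : lift ord0 ord0 = 1 :> 'I_2 by apply: val_inj.
rewrite /form_disc bform_linear bform_quartic meval_quartic.
move: (bS 0 0) (bS 0 1) (dS 0 0) (dS 1 0) => {bS dS}.
move: (cS 0 (inord 0)) (cS 0 (inord 1)) (cS 0 (inord 2)) (cS 0 (inord 3))
  (cS 0 (inord 4)) => {cS}.
move: (b 0 0) (b 0 1) (d 0 0) (d 1 0) => {b d} b0 b1 d0 d1.
move: (c 0 (inord 0)) (c 0 (inord 1)) (c 0 (inord 2)) (c 0 (inord 3))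
  (c 0 (inord 4)) => {c} c0 c1 c2 c3 c4.
move=> c0S c1S c2S c3S c4S b0S b1S d0S d1S bd1.
set q := (X in quartic_disc _ _ _ _ _ * X ^+ 2) => discq.
have qE : q = subst0 (- b1) b0 c0 c1 c2 c3 c4 by rewrite /q /subst0; ring.
have qS : q \in integers S by rewrite /q; closure.
have discS : quartic_disc c0 c1 c2 c3 c4 \in integers S.
  by rewrite /quartic_disc; closure.
have [discu qu] := unit_factor_sqr discS qS discq.
have q0 := unit_neq0 qu; clearbody q.
have divq a : a \in integers S -> exists2 e, e \in integers S & a = q * e.
  by move=> aS; exists (a / q); [closure | rewrite mulrCA divff ?mulr1].
have [e1 e1S E1] : exists2 e, e \in integers S &
    subst1 (- b1) d0 b0 d1 c0 c1 c2 c3 c4 = q * e.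
  by apply: divq; rewrite /subst1; closure.
have [e2 e2S E2] : exists2 e, e \in integers S &
    subst2 (- b1) d0 b0 d1 c0 c1 c2 c3 c4 = q * e.
  by apply: divq; rewrite /subst2; closure.
have [e3 e3S E3] : exists2 e, e \in integers S &
    subst3 (- b1) d0 b0 d1 c0 c1 c2 c3 c4 = q * e.
  by apply: divq; rewrite /subst3; closure.
have [e4 e4S E4] : exists2 e, e \in integers S &
    subst4 d0 d1 c0 c1 c2 c3 c4 = q * e.
  by apply: divq; rewrite /subst4; closure.
have detE : - b1 * d1 - d0 * b0 = - 1.
  have -> : - b1 * d1 - d0 * b0 = - (b0 * d0 + b1 * d1) by ring.
  by rewrite bd1.
have equiv : GL2_equiv S (b0 *: bu + b1 *: bv, quartic c0 c1 c2 c3 c4)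
    (0 *: bu + 1 *: bv, quartic 1 e1 e2 e3 e4).
  apply: (@GL2_equiv_subst _ (- b1) d0 b0 d1 1 q).
  - split; [rewrite rpredN; exact: b1S | exact: d0S | exact: b0S | exact: d1S].
  - by rewrite detE (sign_unit _ true).
  - exact: rpred1.
  - exact: qu.
  - by ring.
  - by rewrite bd1 mulr1.
  - by rewrite -qE E1 E2 E3 E4 mulr1; split; reflexivity.
(* The discriminant has degree 6 in the coefficients, and the determinant enters as (-1)^12. *)
have edisc : q ^+ 6 * quartic_disc 1 e1 e2 e3 e4 = quartic_disc c0 c1 c2 c3 c4.
  rewrite -quartic_discZ -E1 -E2 -E3 -E4 mulr1 qE quartic_disc_subst detE.
  by rewrite -signr_odd expr0 mul1r.
have eu : quartic_disc 1 e1 e2 e3 e4 \in int_units S.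
  rewrite -[X in X \in _](mulKf (expf_neq0 6 q0)) edisc.
  by apply: rpredM discu; rewrite rpredV; apply: rpredX.
have [A [B [x [y [ABS [DS xy equiv']]]]]] :=
  monic_equiv_kappa (And4 e1S e2S e3S e4S) eu.
exists A, B, x, y; split; first exact: ABS.
split; [exact: DS | exact: xy | exact: GL2_equiv_trans equiv equiv'].
Qed.
End Correspondence.

(** * Equivalence classes and the bijection *)

Lemma eqclassE (T : Type) (D : set T) (r : T -> T -> Prop) :
  (forall x, r x x) -> (forall x y, r x y -> r y x) ->
  (forall x y z, r x y -> r y z -> r x z) ->
  forall x y, D x -> eqclass D r x = eqclass D r y <-> r x y.
Proof.
move=> rr rs rt x y Dx; split=> [eq_xy|rxy].
  (* [D x] puts [x] into its own class, hence into that of [y]. *)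
  have : eqclass D r x x by [].
  by rewrite eq_xy => -[_ /rs].
apply/seteqP; split=> z [Dz rz]; split=> //; first exact: rt (rs _ _ rxy) rz.
exact: rt rz.
Qed.

Lemma isom_pm_eqclassE (S : {fset nat}) m m' : calY S m ->
  eqclass (calY S) isom_pm m = eqclass (calY S) isom_pm m' <-> isom m m'.
Proof.
move=> mY; rewrite -isom_pmE; apply: eqclassE => //.
- by move=> x; apply/isom_pmE/isom_refl.
- by move=> x y /isom_pmE xy; apply/isom_pmE/isom_sym.
- by move=> x y z /isom_pmE xy /isom_pmE yz; apply/isom_pmE/isom_trans/yz.
Qed.

Lemma GL2_eqclassE (S : {fset nat}) F F' : admissible S F ->
  eqclass (admissible S) (GL2_equiv S) F =
  eqclass (admissible S) (GL2_equiv S) F' <-> GL2_equiv S F F'.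
Proof.
apply: eqclassE.
- exact: GL2_equiv_refl.
- exact: GL2_equiv_sym.
- exact: GL2_equiv_trans.
Qed.

Lemma short_form_on_curve S m A4 A6 x y : calY S m ->
  short_form S m A4 A6 x y -> on_curve (Marked (short A4 A6) x y).
Proof. by case=> _ Em _ _ [_ _ _ /on_curve_isom]; apply. Qed.

(** From left to right this is the independence of kappa from the representative and the short
    model; from right to left, its injectivity. *)
Lemma short_form_equiv S m m' A4 A6 x y A4' A6' x' y' :
  calY S m -> calY S m' ->
  short_form S m A4 A6 x y -> short_form S m' A4' A6' x' y' ->
  isom m m' <-> GL2_equiv S (kappa_pair A4 x y) (kappa_pair A4' x' y').
Proof.
move=> mY mY' ms ms'.
have E := short_form_on_curve mY ms; have E' := short_form_on_curve mY' ms'.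
case: ms ms' => _ _ DS iso [_ _ DS' iso']; split=> [mm'|equiv].
  apply: GL2_equiv_of_isom DS DS' _; apply: isom_trans (isom_sym iso) _.
  exact: isom_trans mm' iso'.
apply: isom_trans iso _; apply: isom_trans _ (isom_sym iso').
exact: isom_of_GL2_equiv E E' equiv.
Qed.

Theorem theorem4p1 (S : {fset nat})
    (primeS : forall p : nat, p \in S -> prime p)
    (S2 : (2 : nat) \in S) (S3 : (3 : nat) \in S) :
  (forall m : marked_curve, calY S m ->
     exists A4 A6 xt yt : rat, short_form S m A4 A6 xt yt) /\
  exists kappa : set marked_curve -> set form_pair,
    (forall (m : marked_curve) (A4 A6 xt yt : rat),
       calY S m -> short_form S m A4 A6 xt yt ->
       [/\ xt \in integers S, yt \in integers S,
           admissible S (kappa_pair A4 xt yt) &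
           kappa (eqclass (calY S) isom_pm m) =
           eqclass (admissible S) (GL2_equiv S) (kappa_pair A4 xt yt)]) /\
    set_bij (quotient_set (calY S) isom_pm)
            (quotient_set (admissible S) (GL2_equiv S)) kappa.
Proof.
split; first exact: exists_short_form.
(* No choice is made: the value collects what is equivalent to the pair of any short form of any
   representative of [C]. By [kappaE] it is a single class. *)
pose kappa (C : set marked_curve) : set form_pair :=
  [set F | exists m A4 A6 x y, [/\ calY S m, C = eqclass (calY S) isom_pm m,
     short_form S m A4 A6 x y &
     eqclass (admissible S) (GL2_equiv S) (kappa_pair A4 x y) F]]%classic.
have kappa_adm m A4 A6 x y : calY S m -> short_form S m A4 A6 x y ->
    admissible S (kappa_pair A4 x y).
  move=> mY ms; have [xS yS] := short_form_integers mY ms.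
  have := short_form_on_curve mY ms; rewrite /on_curve /= => xy.
  case: ms => AS BS DS _; apply: (@admissible_kappa S S2 A4 A6) => //.
  by ring: xy.
have kappaE m A4 A6 x y : calY S m -> short_form S m A4 A6 x y ->
    kappa (eqclass (calY S) isom_pm m) =
    eqclass (admissible S) (GL2_equiv S) (kappa_pair A4 x y).
  move=> mY ms; apply/seteqP; split=> F; last first.
    by move=> FS; exists m, A4, A6, x, y.
  move=> [m' [A4' [A6' [x' [y' [mY' eqm ms' FS']]]]]].
  suff -> : eqclass (admissible S) (GL2_equiv S) (kappa_pair A4 x y) =
      eqclass (admissible S) (GL2_equiv S) (kappa_pair A4' x' y') by [].
  apply/(GL2_eqclassE _ (kappa_adm _ _ _ _ _ mY ms)).
  by apply/(short_form_equiv mY mY' ms ms')/(isom_pm_eqclassE _ mY).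
exists kappa; split=> [m A4 A6 x y mY ms|].
  have [xS yS] := short_form_integers mY ms.
  by split=> //; [exact: kappa_adm mY ms | exact: kappaE mY ms].
split=> [_ [m mY ->]|C C' /set_mem[m mY ->] /set_mem[m' mY' ->]|_ [F FS ->]].
- have [A4 [A6 [x [y ms]]]] := exists_short_form S2 S3 mY.
  by exists (kappa_pair A4 x y); [exact: kappa_adm mY ms | exact: kappaE mY ms].
- have [A4 [A6 [x [y ms]]]] := exists_short_form S2 S3 mY.
  have [A4' [A6' [x' [y' ms']]]] := exists_short_form S2 S3 mY'.
  rewrite (kappaE _ _ _ _ _ mY ms) (kappaE _ _ _ _ _ mY' ms').
  move/(GL2_eqclassE _ (kappa_adm _ _ _ _ _ mY ms)) => equiv.
  by apply/(isom_pm_eqclassE _ mY)/(short_form_equiv mY mY' ms ms').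
- have [A [B [x [y [[AS BS xS yS] [DS xy equiv]]]]]] :=
    admissible_equiv_kappa S2 S3 FS.
  (* The preimage is the curve just found, which is its own short form. *)
  have mY := calY_short S2 S3 AS BS xS yS DS xy.
  have ms : short_form S (Marked (short A B) x y) A B x y.
    by split=> //; apply: isom_refl.
  exists (eqclass (calY S) isom_pm (Marked (short A B) x y)).
    by exists (Marked (short A B) x y).
  rewrite (kappaE _ _ _ _ _ mY ms); apply/esym/GL2_eqclassE => //.
Qed.
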